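(* Let $a_{4,0},a_{2,2},a_{0,4}\geqslant 0$ and $a_{2,0},a_{0,2}\in\mathbb{R}$ with $a_{4,0}+a_{2,2}>0$ and $a_{2,2}+a_{0,4}>0$, and let $W(x,y)=e^{-q(x,y)}$, where $q(x,y)=a_{4,0}x^4+a_{2,2}x^2y^2+a_{0,4}y^4+a_{2,0}x^2+a_{0,2}y^2$. Let $\{\mathbb{P}_n\}_{n\geqslant0}$ be an orthonormal polynomial system for $W$, with leading coefficient matrices $G_n$ and three term relation matrices $A_{n,1},A_{n,2}$ (see context). Then for every $n\geqslant 0$, \begin{align*} 4a_{4,0}A_{n,1}&\left[(A_{n+1,1}A_{n+1,1}^T)A_{n,1}^T+A_{n,1}^T(A_{n,1}A_{n,1}^T+A_{n-1,1}^TA_{n-1,1})\right]\\ &+2a_{2,2}A_{n,1}\left[(A_{n+1,2}A_{n+1,1}^T)A_{n,2}^T+A_{n,2}^T(A_{n,1}A_{n,2}^T+A_{n-1,1}^TA_{n-1,2})\right]\\ &+2a_{2,0}A_{n,1}A_{n,1}^T=G_nN_{n+1,1}G_n^{-1} \end{align*} and \begin{align*} 4a_{0,4}A_{n,2}&\left[(A_{n+1,2}A_{n+1,2}^T)A_{n,2}^T+A_{n,2}^T(A_{n,2}A_{n,2}^T+A_{n-1,2}^TA_{n-1,2})\right]\\ &+2a_{2,2}A_{n,2}\left[(A_{n+1,1}A_{n+1,2}^T)A_{n,1}^T+A_{n,1}^T(A_{n,2}A_{n,1}^T+A_{n-1,2}^TA_{n-1,1})\right]\\ &+2a_{0,2}A_{n,2}A_{n,2}^T=G_nN_{n+1,2}G_n^{-1}.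 \end{align*}
   Context: Inner product: $(f,g)=\iint_{\mathbb{R}^2} f(x,y)g(x,y)W(x,y)\,dx\,dy$; for vectors/matrices of polynomials it is applied entrywise. For $n\geqslant0$, $\mathbb{X}_n=(x^n,x^{n-1}y,\dots,xy^{n-1},y^n)^T$. An orthonormal polynomial system is a sequence $\{\mathbb{P}_n\}_{n\geqslant0}$ of column vectors $\mathbb{P}_n=(P_{n,0},\dots,P_{n,n})^T$ of real bivariate polynomials, each of total degree exactly $n$, linearly independent, with $(\mathbb{P}_n,\mathbb{P}_n^T)=I_{n+1}$ and $(\mathbb{P}_n,\mathbb{P}_m^T)=0$ for $m\neq n$. Write $\mathbb{P}_n=\sum_{k=0}^nG^n_k\mathbb{X}_k$ with constant $(n+1)\times(k+1)$ matrices $G^n_k$; $G_n:=G^n_n$ is invertible. The orthonormal system satisfies, for $n\geqslant0$ (with $\mathbb{P}_{-1}=0$ and $A_{-1,i}=0$), $x\mathbb{P}_n=A_{n,1}\mathbb{P}_{n+1}+A_{n-1,1}^T\mathbb{P}_{n-1}$ and $y\mathbb{P}_n=A_{n,2}\mathbb{P}_{n+1}+A_{n-1,2}^T\mathbb{P}_{n-1}$, where $A_{n,i}$ are $(n+1)\times(n+2)$ full rank matrices. $N_{n,1}=\mathrm{diag}(n,n-1,\dots,1)$ and $N_{n,2}=\mathrm{diag}(1,2,\dots,n)$ are $n\times n$ matrices (so $N_{n+1,i}$ is $(n+1)\times(n+1)$). *)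

(* Defs.v *)
From HB Require Import structures.
From mathcomp Require Import all_boot all_order all_algebra.
From mathcomp Require Import all_classical all_reals all_analysis.
Set Implicit Arguments. Unset Strict Implicit. Unset Printing Implicit Defensive.
Import Order.TTheory GRing.Theory Num.Theory.
Local Open Scope ring_scope.

Section Defs.
Variable R : realType.

Definition leb2 := ((@lebesgue_measure R) \x (@lebesgue_measure R))%E.

Definition Xvec (k : nat) (z : R * R) : 'cV[R]_k.+1 :=
  \col_(i < k.+1) (z.1 ^+ (k - i) * z.2 ^+ i).

Definition Pvec (G : forall n k : nat, 'M[R]_(n.+1, k.+1)) (n : nat)
  (z : R * R) : 'cV[R]_n.+1 :=
  \sum_(k < n.+1) G n k *m Xvec k z.

Definition Pprev (G : forall n k : nat, 'M[R]_(n.+1, k.+1)) (n : nat)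
  (z : R * R) : 'cV[R]_n :=
  match n return 'cV[R]_n with 0 => 0 | m.+1 => Pvec G m z end.

Definition Aprev (A : forall n : nat, 'M[R]_(n.+1, n.+2)) (n : nat)
  : 'M[R]_(n, n.+1) :=
  match n return 'M[R]_(n, n.+1) with 0 => 0 | m.+1 => A m end.

Definition qpoly (a40 a22 a04 a20 a02 : R) (z : R * R) : R :=
  a40 * z.1 ^+ 4 + a22 * z.1 ^+ 2 * z.2 ^+ 2 + a04 * z.2 ^+ 4
  + a20 * z.1 ^+ 2 + a02 * z.2 ^+ 2.

Definition weight (a40 a22 a04 a20 a02 : R) (z : R * R) : R :=
  expR (- qpoly a40 a22 a04 a20 a02 z).

Definition ip (W : R * R -> R) (f g : R * R -> R) : R :=
  Rintegral leb2 setT (fun z => f z * g z * W z).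

(* {P_n} (given by its coefficient matrices G^n_k) is an orthonormal
   polynomial system for W: leading matrices G_n = G^n_n invertible
   (so each P_{n,i} has total degree exactly n and they are linearly
   independent), the inner products are well defined (integrable), and
   (P_n, P_m^T) = delta_{nm} I. *)
Definition orthonormal_system (W : R * R -> R)
  (G : forall n k : nat, 'M[R]_(n.+1, k.+1)) : Prop :=
  (forall n, G n n \in unitmx) /\
  (forall (n m : nat) (i : 'I_n.+1) (j : 'I_m.+1),
      leb2.-integrable setT
        (fun z => (Pvec G n z i 0 * Pvec G m z j 0 * W z)%:E)) /\
  (forall (n m : nat) (i : 'I_n.+1) (j : 'I_m.+1),
      ip W (fun z => Pvec G n z i 0) (fun z => Pvec G m z j 0)
      = ((n == m) && (val i == val j))%:R).

Definition N1 (n : nat) : 'M[R]_n := diag_mx (\row_(i < n) (n - i)%:R).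
Definition N2 (n : nat) : 'M[R]_n := diag_mx (\row_(i < n) (i.+1)%:R).

End Defs.

(* Main.v *)
(* The entries of P_n are lifted to the polynomial ring in two variables, where
   the three term relations become identities, and L p denotes the integral of
   p * W.  Integrability of all polynomials against W follows from that of the
   products P_n * P_m, because P_0 is a nonzero constant and the P_n span.

   Since F and F' are integrable along almost every line when F = p * W, both
   limits of F at infinity exist and vanish, so Fubini gives L (d_x p) =
   L (q_x * p).  Apply this to the entries of p = u * P_n^T with
   u = A_{n,1} P_{n+1} = x P_n - A_{n-1,1}^T P_{n-1}.
   By orthogonality to lower degrees, L (u * d_x P_n^T) = 0 and
   L (d_x u * P_n^T) = L (d_x (x P_n) * P_n^T) = G_n N_{n+1,1} G_n^-1, the last
   step because d_x (x X_k) = N_{k+1,1} X_k.  Expanding L (q_x * u * P_n^T)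
   with the three term relations yields the left-hand side. *)
Require Import Defs.
From HB Require Import structures.
From mathcomp Require Import all_boot all_order all_algebra.
From mathcomp Require Import all_classical all_reals all_analysis.
From mathcomp Require Import measurable_realfun polyXY zify ring lra.
Import Order.TTheory GRing.Theory Num.Theory.
Import numFieldNormedType.Exports.
Local Open Scope ring_scope.

Set Implicit Arguments.
Unset Strict Implicit.
Unset Printing Implicit Defensive.

(** * Integrals over the line of a derivative with integrable primitive *)

Section integral_of_derivative.
Local Open Scope classical_set_scope.

(** Chebyshev's argument: if [D] had infinite measure, the constant [e] would have infinite integral
    over [D], yet that integral is bounded by the finite integral of [|F|]. *)
Lemma integrable_ge_measure_lty {d} {T : measurableType d} {R : realType}
    (mu : {measure set T -> \bar R}) (F : T -> R) (e : R) (D : set T) :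
  measurable D -> mu.-integrable setT (EFin \o F) -> 0 < e ->
  (forall x, D x -> e <= `|F x|) -> (mu D < +oo)%E.
Proof.
move=> mD iF e0 eF.
have /integrableP[mF] : mu.-integrable D (EFin \o F).
  by apply: integrableS iF.
apply: contraLR; rewrite -!leNgt !leye_eq => /eqP muD; rewrite -leye_eq.
have <- : (\int[mu]_(x in D) (cst e%:E x) = +oo)%E.
  by rewrite integral_cst// muD gt0_muley// lte_fin.
apply: ge0_le_integral => //=.
- by move=> x _; rewrite lee_fin ltW.
- exact/measurable_EFinP/measurableT_comp/measurable_EFinP.
Qed.

Variable R : realType.
Local Notation mu := (@lebesgue_measure R).

(** A nonzero limit would keep [|F|] above [|L| / 2] on a half-line, a set of infinite measure. *)
Lemma integrable_cvgy_eq0 (F : R -> R) (L : R) :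
  mu.-integrable setT (EFin \o F) -> F x @[x --> +oo] --> L -> L = 0.
Proof.
move=> iF FL; apply/eqP/negPn/negP => L0.
have L2 : 0 < `|L| / 2 by rewrite divr_gt0// normr_gt0.
have : \forall x \near +oo, `|L| / 2 < `|F x|.
  apply: (cvgr_gt _ (cvg_norm FL)).
  by rewrite gtr_pMr ?normr_gt0//; lra.
move=> [X [_ FX]].
have : (mu `]X, +oo[ < +oo)%E.
  apply: (@integrable_ge_measure_lty _ _ _ mu F (`|L| / 2)) => //= x.
  by rewrite in_itv/= andbT => /FX/ltW.
by rewrite lebesgue_measure_itv/= ltry ltxx.
Qed.

Lemma integrable_cvgNy_eq0 (F : R -> R) (L : R) :
  mu.-integrable setT (EFin \o F) -> F x @[x --> -oo] --> L -> L = 0.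
Proof.
move=> iF FL; apply/eqP/negPn/negP => L0.
have L2 : 0 < `|L| / 2 by rewrite divr_gt0// normr_gt0.
have : \forall x \near -oo, `|L| / 2 < `|F x|.
  apply: (cvgr_gt _ (cvg_norm FL)).
  by rewrite gtr_pMr ?normr_gt0//; lra.
move=> [X [_ FX]].
have : (mu `]-oo, X[ < +oo)%E.
  apply: (@integrable_ge_measure_lty _ _ _ mu F (`|L| / 2)) => //= x.
  by rewrite in_itv/= => /FX/ltW.
by rewrite lebesgue_measure_itv/= ltNyr ltxx.
Qed.

(** Dominated convergence for [f] cut off to [D_ n], with dominating function [|f|]. The sets need
    not be nested, so endpoints may follow an arbitrary divergent sequence. *)
Lemma cvg_Rintegral_exhaust (f : R -> R) (D : set R) (D_ : (set R)^nat) :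
  mu.-integrable setT (EFin \o f) -> measurable D ->
  (forall n, measurable (D_ n)) -> (forall n, D_ n `<=` D) ->
  (forall x, D x -> \forall n \near \oo, D_ n x) ->
  (\int[mu]_(x in D_ n) f x)%R @[n --> \oo] --> (\int[mu]_(x in D) f x)%R.
Proof.
move=> iF mD mD_ sD cD.
have iD : mu.-integrable D (EFin \o f) by exact: integrableS iF.
have mf : measurable_fun D (EFin \o f) by exact: measurable_int iD.
have [] := @dominated_convergence _ _ R mu D mD
  (fun n => EFin \o (f \_ (D_ n))) (EFin \o f) (abse \o (EFin \o f)).
- move=> n; apply/measurable_EFinP; apply/measurable_restrict => //.
    exact: mD_.
  apply: (@measurable_funS _ _ _ _ D) => //; last exact/measurable_EFinP.
- exact: mf.
- apply: aeW => x Dx /=; apply: cvg_near_cst.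
  by near=> n; rewrite patchE mem_set//; near: n; exact: cD.
- exact: integrable_abse.
- apply: aeW => x n Dx /=; rewrite patchE lee_fin.
  by case: ifPn => // _; rewrite normr0.
move=> _ _ /=.
rewrite -[X in _ --> X]fineK; last exact: integrable_fin_num.
move/fine_cvg => /=; apply: cvg_trans; apply: near_eq_cvg; near=> n => /=.
rewrite -/(Rintegral mu D (f \_ (D_ n))) -Rintegral_mkcondr.
by rewrite (setIidr (sD n)).
Unshelve. all: by end_near. Qed.

Variables F f : R -> R.
Hypothesis dF : forall x, is_derive x (1 : R) F (f x).
Hypothesis cf : continuous f.
Hypothesis iF : mu.-integrable setT (EFin \o F).
Hypothesis jf : mu.-integrable setT (EFin \o f).

Let cF : continuous F.
Proof.
move=> x; apply/differentiable_continuous/derivable1_diffP.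
exact: (@ex_derive _ _ _ _ _ _ _ (dF x)).
Qed.

Lemma Rintegral_derive_itv (a b : R) : a <= b ->
  (\int[mu]_(x in `[a, b]) f x)%R = F b - F a.
Proof.
rewrite le_eqVlt => /predU1P[->|ab].
  by rewrite set_itv1 Rintegral_set1 subrr.
rewrite /Rintegral (@continuous_FTC2 _ f F)//.
- exact: continuous_subspaceT.
- split; first by move=> x _; exact: (@ex_derive _ _ _ _ _ _ _ (dF x)).
  + apply: cvg_within_filter; exact: cF.
  + apply: cvg_within_filter; exact: cF.
- by move=> x _; rewrite derive1E (@derive_val _ _ _ _ _ _ _ (dF x)).
Qed.

(* Both F(+oo) and F(-oo) exist since f is integrable, and vanish since F is. *)
Lemma Rintegral_derive_eq0 : (\int[mu]_x f x)%R = 0.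
Proof.
have Fy : F x @[x --> +oo] --> (\int[mu]_(x in `[0%R, +oo[) f x)%R + F 0.
  (* The limit is tested along an arbitrary sequence [u] tending to infinity; once [u n] is
     nonnegative, [F (u n)] is [F 0] plus the integral of [f] from 0 to [u n]. *)
  apply/cvg_pinftyP => u uy.
  have : (\int[mu]_(x in `[0%R, u n]) f x)%R @[n --> \oo] -->
         (\int[mu]_(x in `[0%R, +oo[) f x)%R.
    apply: cvg_Rintegral_exhaust => // [n x|x] /=; rewrite !in_itv/= ?andbT.
      by case/andP.
    move=> x0; near=> n; rewrite in_itv/= x0.
    by near: n; move/cvgryPge : uy; exact.
  move=> Iu; apply: cvg_trans (cvgD Iu (cvg_cst (F 0))).
  apply: near_eq_cvg; near=> n => /=.
  rewrite fctE Rintegral_derive_itv ?subrK//.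
  by near: n; move/cvgryPge : uy; exact.
have FNy : F x @[x --> -oo] --> F 0 - (\int[mu]_(x in `]-oo, 0%R]) f x)%R.
  apply/cvg_ninftyP => u uy.
  have : (\int[mu]_(x in `[u n, 0%R]) f x)%R @[n --> \oo] -->
         (\int[mu]_(x in `]-oo, 0%R]) f x)%R.
    apply: cvg_Rintegral_exhaust => // [n x|x] /=; rewrite !in_itv/=.
      by case/andP.
    move=> x0; near=> n; rewrite in_itv/= x0 andbT.
    by near: n; move/cvgrNyPle : uy; exact.
  move=> Iu; apply: cvg_trans (cvgB (cvg_cst (F 0)) Iu).
  apply: near_eq_cvg; near=> n => /=.
  rewrite -[LHS]/(F 0 - \int[mu]_(x in `[u n, 0%R]) f x)%R.
  rewrite Rintegral_derive_itv ?subKr//.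
  by near: n; move/cvgrNyPle : uy; exact.
have := Fy; rewrite (integrable_cvgy_eq0 iF Fy) => {}Fy.
have := FNy; rewrite (integrable_cvgNy_eq0 iF FNy) => {}FNy.
have nN : (- (n%:R : R)) @[n --> \oo] --> -oo.
  apply/cvgrNyPle => A; near=> n; rewrite lerNl.
  by near: n; exact: nbhs_infty_ger.
(* The integrals over [[-n, n]] tend both to the difference of the two vanishing limits of [F] and
   to the full integral of [f]. *)
have FF : F n%:R - F (- n%:R) @[n --> \oo] --> 0.
  rewrite -[X in _ --> X]subr0.
  apply: cvgB; first exact: (cvg_pinftyP _ _).1 Fy _ (@cvgr_idn R).
  exact: (cvg_ninftyP _ _).1 FNy _ nN.
have FI : (\int[mu]_(x in `[- (n%:R : R), n%:R]) f x)%R @[n --> \oo] -->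
       (\int[mu]_x f x)%R.
  apply: cvg_Rintegral_exhaust => // x _.
  near=> n; rewrite /= in_itv/= -ler_norml.
  by near: n; exact: nbhs_infty_ger.
apply: (cvg_unique (@norm_hausdorff _ _) _ FF); apply: cvg_trans FI.
apply: near_eq_cvg; near=> n.
by rewrite Rintegral_derive_itv// ge0_cp.
Unshelve. all: by end_near. Qed.

End integral_of_derivative.

(** * Integration by parts against exp(-Q) in the plane *)

Section planar_integration_by_parts.
Local Open Scope classical_set_scope.
Variable R : realType.
Local Notation mu := (@lebesgue_measure R).
Implicit Types (p q : {poly R}) (P Q : {poly {poly R}}).

Lemma is_derive_horner_expR p q (x : R) :
  is_derive x (1 : R) (fun t => p.[t] * expR (- q.[t]))
    ((p^`() - q^`() * p).[x] * expR (- q.[x])).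
Proof.
apply: is_derive_eq; rewrite !hornerE /GRing.scale/=; ring.
Qed.

Lemma continuous_horner_expR p q :
  continuous (fun t : R => p.[t] * expR (- q.[t])).
Proof.
move=> x; apply/differentiable_continuous/derivable1_diffP.
exact: (@ex_derive _ _ _ _ _ _ _ (is_derive_horner_expR p q x)).
Qed.

Lemma Rintegral_horner_expR_eq0 p q :
  mu.-integrable setT (fun x => (p.[x] * expR (- q.[x]))%:E) ->
  mu.-integrable setT
    (fun x => ((p^`() - q^`() * p).[x] * expR (- q.[x]))%:E) ->
  (\int[mu]_x ((p^`() - q^`() * p).[x] * expR (- q.[x])))%R = 0.
Proof.
move=> ip idp; apply: (Rintegral_derive_eq0 (is_derive_horner_expR p q)) => //.
exact: continuous_horner_expR.
Qed.

(* A polynomial p(x, y) is represented with outer variable x, so that deriv is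
   the partial derivative in x and derivY the one in y. *)
Definition derivY : {poly {poly R}} -> {poly {poly R}} :=
  swapXY \o @deriv _ \o swapXY.

HB.instance Definition _ :=
  GRing.Additive.copy derivY (swapXY \o @deriv _ \o swapXY).

Lemma derivYM P Q : derivY (P * Q) = derivY P * Q + P * derivY Q.
Proof. by rewrite /derivY /= rmorphM derivM rmorphD !rmorphM /= !swapXYK. Qed.

Lemma derivYC p : derivY p%:P = (deriv p)%:P.
Proof. by rewrite /derivY /= swapXY_polyC deriv_map swapXY_map_polyC. Qed.

Lemma derivY_X : derivY 'X = 0.
Proof. by rewrite /derivY /= swapXY_X derivC rmorph0. Qed.

(** Freezing the inner variable y amounts to evaluating the coefficients. What remains is a
    univariate polynomial in x, and [deriv] commutes with this coefficient map, so horizontal slices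
    fall under the one-variable case. *)
Lemma hornerX_map P (x y : R) : P.[x, y] = (map_poly (horner_eval y) P).[x].
Proof. by rewrite -horner_swapXY horner2_swapXY. Qed.

Lemma horner_derivY P (x : R) : (derivY P).[x%:P] = deriv P.[x%:P].
Proof.
by rewrite /derivY /= horner_swapXY -deriv_map -horner_swapXY swapXYK.
Qed.

Variable Q : {poly {poly R}}.
Let W (z : R * R) := expR (- Q.[z.1, z.2]).
Hypothesis intW : forall P,
  (@leb2 R).-integrable setT (fun z => (P.[z.1, z.2] * W z)%:E).

(** The integrand is the x-derivative of [P * exp(-Q)]. With x integrated first, almost every
    horizontal slice has both this derivative and its primitive integrable, so almost every inner
    integral is 0. *)
Lemma Rintegral_derivX_expR_eq0 P :
  Rintegral (@leb2 R) setT (fun z => (P^`() - Q^`() * P).[z.1, z.2] * W z) = 0.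
Proof.
rewrite /Rintegral -(integral21_prod_meas1 (intW _)).
rewrite (ae_eq_integral (cst 0%E)) ?integral0//.
- exact: measurable_fubini_G (intW _).
- have := ae_integrable2 (intW P).
  apply: filterS2 (ae_integrable2 (intW (P^`() - Q^`() * P))) => y /=.
  rewrite /W /fubini_G /= => idP iP _.
  set f := fun x : R => _.
  have fE : f = (fun x => let p := map_poly (horner_eval y) P in
      let q := map_poly (horner_eval y) Q in
      ((p^`() - q^`() * p).[x] * expR (- q.[x]))%:E).
    apply/funext => x; rewrite /f !hornerX_map.
    by rewrite rmorphB rmorphM !deriv_map.
  (* Integrability of the slice makes the inner integral finite, which turns the equation between
     extended reals into one between reals. *)
  rewrite -[LHS]fineK; last first.
    by apply: integrable_fin_num.
  congr (_%:E).
  rewrite fE /=; apply: Rintegral_horner_expR_eq0.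
    by under eq_fun do rewrite -!hornerX_map.
  by rewrite -fE.
Qed.


Lemma Rintegral_derivY_expR_eq0 P :
  Rintegral (@leb2 R) setT
    (fun z => (derivY P - derivY Q * P).[z.1, z.2] * W z) = 0.
Proof.
rewrite /Rintegral -(integral12_prod_meas1 (intW _)).
rewrite (ae_eq_integral (cst 0%E)) ?integral0//.
- exact: measurable_fubini_F (intW _).
- have := ae_integrable1 (intW P).
  apply: filterS2 (ae_integrable1 (intW (derivY P - derivY Q * P))) => x /=.
  rewrite /W /fubini_F /= => idP iP _.
  set f := fun y : R => _.
  have fE : f = (fun y => let p := P.[x%:P] in
      let q := Q.[x%:P] in
      ((p^`() - q^`() * p).[y] * expR (- q.[y]))%:E).
    apply/funext => y; rewrite /f.
    by rewrite !(hornerD, hornerN, hornerM) !horner_derivY.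
  rewrite -[LHS]fineK; last first.
    by apply: integrable_fin_num.
  congr (_%:E).
  rewrite fE /=; apply: Rintegral_horner_expR_eq0.
    exact: iP.
  by rewrite -fE.
Qed.


(** Bundling integration as an additive map lets the rest of the argument be pure algebra about an
    abstract functional [L]. *)
Lemma Rintegral_additive : exists L : {additive {poly {poly R}} -> R},
  forall P, L P = Rintegral (@leb2 R) setT (fun z => P.[z.1, z.2] * W z).
Proof.
pose L P := Rintegral (@leb2 R) setT (fun z => P.[z.1, z.2] * W z).
have LB : {morph L : P P' / P - P'}.
  move=> P P'; rewrite /L -RintegralB//; [|exact: intW|exact: intW].
  by apply: eq_Rintegral => z _; rewrite !(hornerD, hornerN) mulrBl.
pose La := GRing.isZmodMorphism.Build _ _ L LB.
by exists (HB.pack_for {additive {poly {poly R}} -> R} L La).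
Qed.

End planar_integration_by_parts.

(** * Algebra of orthogonal vectors under a functional [L] and a derivation [D] *)

Section structure_relation.
Variables (R : realType) (B : comNzRingType) (c : {rmorphism R -> B}).
Variable L : {additive B -> R}.
Hypothesis LZ : forall a p, L (c a * p) = a * L p.

(** The algebraic counterpart of the matrix inner product (U, V^T). *)
Definition pairing m n (U : 'cV[B]_m) (V : 'cV[B]_n) : 'M[R]_(m, n) :=
  map_mx L (U *m V^T).

Lemma pairingE m n (U : 'cV[B]_m) (V : 'cV[B]_n) i j :
  pairing U V i j = L (U i 0 * V j 0).
Proof. by rewrite !mxE big_ord1 mxE. Qed.

Lemma pairingDl m n (U U' : 'cV[B]_m) (V : 'cV[B]_n) :
  pairing (U + U') V = pairing U V + pairing U' V.
Proof. by rewrite /pairing mulmxDl map_mxD. Qed.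

Lemma pairingDr m n (U : 'cV[B]_m) (V V' : 'cV[B]_n) :
  pairing U (V + V') = pairing U V + pairing U V'.
Proof. by rewrite /pairing linearD mulmxDr map_mxD. Qed.

Lemma pairing_tr m n (U : 'cV[B]_m) (V : 'cV[B]_n) :
  (pairing U V)^T = pairing V U.
Proof. by apply/matrixP => i j; rewrite mxE !pairingE mulrC. Qed.

Lemma pairing_mull m n k (A : 'M[R]_(m, k)) (U : 'cV[B]_k) (V : 'cV[B]_n) :
  pairing (map_mx c A *m U) V = A *m pairing U V.
Proof.
apply/matrixP => i j; rewrite /pairing -mulmxA !mxE raddf_sum.
by apply: eq_bigr => l _; rewrite !mxE LZ.
Qed.

Lemma pairing_mulr m n k (A : 'M[R]_(n, k)) (U : 'cV[B]_m) (V : 'cV[B]_k) :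
  pairing U (map_mx c A *m V) = pairing U V *m A^T.
Proof.
by rewrite -pairing_tr pairing_mull trmx_mul pairing_tr.
Qed.

Lemma pairing0l m n (V : 'cV[B]_n) : pairing (0 : 'cV_m) V = 0.
Proof. by rewrite /pairing mul0mx map_mx0. Qed.

Lemma pairing0r m n (U : 'cV[B]_m) : pairing U (0 : 'cV_n) = 0.
Proof. by rewrite -pairing_tr pairing0l trmx0. Qed.

Lemma pairingZ m n (p : B) (U : 'cV[B]_m) (V : 'cV[B]_n) :
  pairing (p *: U) V = pairing U (p *: V).
Proof. by apply/matrixP => i j; rewrite !pairingE !mxE mulrCA mulrA. Qed.

Lemma pairing_scalar m n (a : R) (U : 'cV[B]_m) (V : 'cV[B]_n) :
  pairing (c a *: U) V = a *: pairing U V.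
Proof. by apply/matrixP => i j; rewrite [RHS]mxE !pairingE mxE -mulrA LZ. Qed.

Lemma pairing_suml m n k (U : 'I_k -> 'cV[B]_m) (V : 'cV[B]_n) :
  pairing (\sum_i U i) V = \sum_i pairing (U i) V.
Proof.
apply: (big_ind2 (fun u M => pairing u V = M)) => [|u1 M1 u2 M2 <- <-|//].
  exact: pairing0l.
exact: pairingDl.
Qed.

Variables x y : B.

Definition monomials k : 'cV[B]_k.+1 := \col_(i < k.+1) (x ^+ (k - i) * y ^+ i).

Variable G : forall n k : nat, 'M[R]_(n.+1, k.+1).

Definition opoly n : 'cV[B]_n.+1 :=
  \sum_(k < n.+1) map_mx c (G n k) *m monomials k.

Definition opoly_prev n : 'cV[B]_n :=
  match n return 'cV[B]_n with 0 => 0 | m.+1 => opoly m end.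

Hypothesis Gunit : forall n, G n n \in unitmx.
Hypothesis ortho : forall n m i j,
  L (opoly n i 0 * opoly m j 0) = ((n == m) && (val i == val j))%:R.

Lemma pairing_opoly n : pairing (opoly n) (opoly n) = 1%:M.
Proof. by apply/matrixP => i j; rewrite pairingE ortho eqxx mxE. Qed.

Lemma pairing_opoly_neq n m : n != m -> pairing (opoly n) (opoly m) = 0.
Proof.
by move=> nm; apply/matrixP => i j; rewrite pairingE ortho (negbTE nm) mxE.
Qed.

Lemma opolyE n : opoly n =
  \sum_(k < n) map_mx c (G n k) *m monomials k
  + map_mx c (G n n) *m monomials n.
Proof. by rewrite /opoly big_ord_recr. Qed.

(** Strong induction on [k]: in (P_k, P_n^T) = 0 the monomials of degree below [k] contribute
    nothing, and the remaining leading matrix [G k k] can be cancelled. *)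
Lemma pairing_monomials_lt k n : (k < n)%N ->
  pairing (monomials k) (opoly n) = 0.
Proof.
elim/ltn_ind: k => k IH kn.
have : pairing (opoly k) (opoly n) = 0.
  by rewrite pairing_opoly_neq// ltn_eqF.
rewrite opolyE pairingDl pairing_suml big1 ?add0r; last first.
  by move=> i _; rewrite pairing_mull IH ?mulmx0// (ltn_trans _ kn).
rewrite pairing_mull => /(congr1 (mulmx (invmx (G k k)))).
by rewrite mulKmx// mulmx0.
Qed.

(** Only the leading term of the left-hand P_n survives in (P_n, P_n^T) = I, so the pairing is a
    right inverse of [G n n]. *)
Lemma pairing_monomials n : pairing (monomials n) (opoly n) = invmx (G n n).
Proof.
have := pairing_opoly n.
rewrite {1}opolyE pairingDl pairing_suml big1 ?add0r; last first.
  by move=> i _; rewrite pairing_mull pairing_monomials_lt ?mulmx0.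
rewrite pairing_mull => /(congr1 (mulmx (invmx (G n n)))).
by rewrite mulKmx// mulmx1.
Qed.

Lemma opoly_monomial_eq0 a b n i : (a + b < n)%N ->
  L (x ^+ a * y ^+ b * opoly n i 0) = 0.
Proof.
move=> abn; have bab : (b < (a + b).+1)%N by rewrite ltnS leq_addl.
have /matrixP/(_ (Ordinal bab) i) := pairing_monomials_lt abn.
by rewrite pairingE !mxE /= addnK.
Qed.

(** One factor [w] stays on P_{n+1}, while [v] and the other [w] move to P_n; the three term
    relations and orthonormality then leave three products. Taking [w = v] gives the cubic term of
    the gradient, and distinct variables give the mixed one. *)
Lemma pairing_quartic (v w : B) (Av Aw : forall n : nat, 'M[R]_(n.+1, n.+2)) n :
  (forall n, v *: opoly n = map_mx c (Av n) *m opoly n.+1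
                          + map_mx c (Aprev Av n)^T *m opoly_prev n) ->
  (forall n, w *: opoly n = map_mx c (Aw n) *m opoly n.+1
                          + map_mx c (Aprev Aw n)^T *m opoly_prev n) ->
  pairing ((v * w ^+ 2) *: opoly n.+1) (opoly n)
  = (Aw n.+1 *m (Av n.+1)^T) *m (Aw n)^T
    + (Aw n)^T *m (Av n *m (Aw n)^T + (Aprev Av n)^T *m Aprev Aw n).
Proof.
move=> Hv Hw.
have nn2 : n.+2 != n by lia.
have prev0 : pairing (opoly n.+2) (v *: opoly_prev n) = 0.
  case: n nn2 => [|m] _ /=; first by rewrite scaler0 pairing0r.
  rewrite Hv pairingDr !pairing_mulr pairing_opoly_neq; last by lia.
  case: m => [|m] /=; first by rewrite pairing0r !mul0mx addr0.
  by rewrite pairing_opoly_neq ?mul0mx ?addr0//; lia.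
have prev1 : pairing (opoly n) (v *: opoly_prev n) = (Aprev Av n)^T.
  (* For [n = 0] the previous vector is empty, and both sides are matrices without columns. *)
  case: n {nn2 prev0} => [|m] /=.
    by rewrite scaler0 pairing0r; apply/matrixP => i [].
  rewrite Hv pairingDr !pairing_mulr pairing_opoly mul1mx.
  case: m => [|m] /=; first by rewrite pairing0r !mul0mx addr0.
  by rewrite pairing_opoly_neq ?mul0mx ?addr0//; lia.
have -> : (v * w ^+ 2) *: opoly n.+1 = (v * w) *: (w *: opoly n.+1).
  by rewrite scalerA -mulrA.
rewrite pairingZ -scalerA !Hw /= scalerDr.
have scaleC k m (a : B) (A : 'M[R]_(k, m)) (U : 'cV_m) :
    a *: (map_mx c A *m U) = map_mx c A *m (a *: U) by rewrite scalemxAr.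
rewrite !scaleC Hv /= mulmxDr.
rewrite !(pairingDl, pairingDr, pairing_mull, pairing_mulr) !pairing_opoly.
rewrite prev0 prev1 !pairing_opoly_neq//; last by lia.
rewrite !(mul0mx, mulmx0, mul1mx, mulmx1, add0r, addr0, trmxK) !mulmxA.
by rewrite mulmxDr !mulmxA addrA.
Qed.

Variable D : {additive B -> B}.
Hypothesis DM : forall p q, D (p * q) = D p * q + p * D q.
Hypothesis Dc : forall a, D (c a) = 0.

(** At [k = 0] the truncated exponent [k.-1] is harmless because its coefficient vanishes. *)
Lemma derivation_exp p k : D (p ^+ k) = c k%:R * p ^+ k.-1 * D p.
Proof.
elim: k => [|k IH].
  by rewrite expr0 -(rmorph1 c) Dc rmorph0 !mul0r.
rewrite exprS DM {}IH; case: k => [|k]; first by rewrite rmorph0 !rmorph1; ring.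
by rewrite -[k.+2%:R]natr1 rmorphD rmorph1 exprS /=; ring.
Qed.

Lemma map_derivation_mul m n (A : 'M[R]_(m, n)) (U : 'cV_n) :
  map_mx D (map_mx c A *m U) = map_mx c A *m map_mx D U.
Proof.
apply/matrixP => i j; rewrite !mxE raddf_sum; apply: eq_bigr => k _.
by rewrite !mxE DM Dc mul0r add0r.
Qed.

Lemma pairing_derivation m n (U : 'cV[B]_m) (V : 'cV[B]_n) :
  map_mx (L \o D) (U *m V^T) = pairing (map_mx D U) V + pairing U (map_mx D V).
Proof.
apply/matrixP => i j; rewrite [RHS]mxE !pairingE !mxE big_ord1 !mxE.
by rewrite /= DM raddfD.
Qed.

Variables dx dy : R.
Hypotheses (Dx : D x = c dx) (Dy : D y = c dy).

(** Since [D] maps x and y to constants, it does not raise the degree, so orthogonality to degrees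
    below [n] still applies. *)
Lemma pairing_derivation_monomials_lt k n : (k < n)%N ->
  pairing (map_mx D (monomials k)) (opoly n) = 0.
Proof.
move=> kn; apply/matrixP => i j; rewrite pairingE !mxE DM !derivation_exp Dx Dy.
have ik : (i <= k)%N by rewrite -ltnS.
pose a := (k - i)%N; rewrite -/a.
have -> : (c a%:R * x ^+ a.-1 * c dx * y ^+ i
     + x ^+ a * (c i%:R * y ^+ i.-1 * c dy)) * opoly n j 0
  = c (a%:R * dx) * (x ^+ a.-1 * y ^+ i * opoly n j 0)
  + c (i%:R * dy) * (x ^+ a * y ^+ i.-1 * opoly n j 0).
  by rewrite !rmorphM; ring.
(* The degree bounds [a.-1 + i < n] and [a + i.-1 < n] hold even where a predecessor is
   truncated. *)
rewrite raddfD/= !LZ !opoly_monomial_eq0 ?mulr0 ?addr0//; rewrite /a; lia.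
Qed.

Lemma pairing_derivation_opoly_lt k n : (k < n)%N ->
  pairing (map_mx D (opoly k)) (opoly n) = 0.
Proof.
move=> kn; have -> : map_mx D (opoly k) =
    \sum_(l < k.+1) map_mx c (G k l) *m map_mx D (monomials l).
  rewrite /opoly (raddf_sum (map_mx D)); apply: eq_bigr => l _.
    by rewrite -map_derivation_mul.
rewrite pairing_suml big1// => l _.
rewrite pairing_mull pairing_derivation_monomials_lt ?mulmx0//.
exact: leq_trans kn.
Qed.

(** Keeping [dx] and [dy] general covers both partial derivatives: (1, 0) selects the first summand,
    (0, 1) the second. The mixed terms are ordered to fit the shape [v * w ^+ 2]. *)
Lemma derivation_quartic a b e d f :
  D (c a * x ^+ 4 + c b * (x ^+ 2 * y ^+ 2) + c e * y ^+ 4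
     + c d * x ^+ 2 + c f * y ^+ 2)
  = (c (4 * a) * x ^+ 3 + c (2 * b) * (x * y ^+ 2) + c (2 * d) * x) * c dx
  + (c (4 * e) * y ^+ 3 + c (2 * b) * (y * x ^+ 2) + c (2 * f) * y) * c dy.
Proof.
have DcM g p : D (c g * p) = c g * D p by rewrite DM Dc mul0r add0r.
rewrite !raddfD /= !DcM (DM (x ^+ 2)) !derivation_exp Dx Dy.
rewrite !(rmorphM, rmorph_nat) /= !expr1.
move: (c a) (c b) (c e) (c d) (c f) (c dx) (c dy) (x) (y); clear => *; ring.
Qed.

Lemma derivation_mulX_monomials k : dx = 1 -> dy = 0 ->
  map_mx D (x *: monomials k) = map_mx c (N1 R k.+1) *m monomials k.
Proof.
move=> dx1 dy0; rewrite map_diag_mx mul_diag_mx.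
apply/matrixP => i j.
rewrite !mxE mulrA -exprS DM !derivation_exp Dx Dy dx1 dy0.
have ik : (i <= k)%N by rewrite -ltnS.
rewrite rmorph1 rmorph0 /= subSn//; ring.
Qed.

Lemma derivation_mulY_monomials k : dx = 0 -> dy = 1 ->
  map_mx D (y *: monomials k) = map_mx c (N2 R k.+1) *m monomials k.
Proof.
move=> dx0 dy1; rewrite map_diag_mx mul_diag_mx.
apply/matrixP => i j.
rewrite !mxE mulrCA -exprS DM !derivation_exp Dx Dy dx0 dy1.
rewrite rmorph1 rmorph0 /=; ring.
Qed.

Variables (v w : B) (Av Aw : forall n : nat, 'M[R]_(n.+1, n.+2)).
Variable N : forall n, 'M[R]_n.
Hypothesis Hv : forall n, v *: opoly n = map_mx c (Av n) *m opoly n.+1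
                          + map_mx c (Aprev Av n)^T *m opoly_prev n.
Hypothesis Hw : forall n, w *: opoly n = map_mx c (Aw n) *m opoly n.+1
                          + map_mx c (Aprev Aw n)^T *m opoly_prev n.
Hypothesis DN : forall k,
  map_mx D (v *: monomials k) = map_mx c (N k.+1) *m monomials k.
Variables a b d : R.
Hypothesis LD : forall p,
  L (D p) =
  L ((c (4 * a) * v ^+ 3 + c (2 * b) * (v * w ^+ 2) + c (2 * d) * v) * p).

(** The pair (v, w) stands for (x, y) or (y, x), so one proof serves both identities; the two sides
    are two evaluations of [L] on the entries of D(U P_n^T). *)
Lemma structure_relation n :
  (4 * a) *: (Av n *m ((Av n.+1 *m (Av n.+1)^T) *m (Av n)^T
      + (Av n)^T *m (Av n *m (Av n)^T + (Aprev Av n)^T *m Aprev Av n)))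
  + (2 * b) *: (Av n *m ((Aw n.+1 *m (Av n.+1)^T) *m (Aw n)^T
      + (Aw n)^T *m (Av n *m (Aw n)^T + (Aprev Av n)^T *m Aprev Aw n)))
  + (2 * d) *: (Av n *m (Av n)^T)
  = G n n *m N n.+1 *m invmx (G n n).
Proof.
pose U := map_mx c (Av n) *m opoly n.+1.
have DL : map_mx (L \o D) (U *m (opoly n)^T) =
    G n n *m N n.+1 *m invmx (G n n).
  rewrite pairing_derivation.
  rewrite pairing_mull -[X in _ + _ *m X]pairing_tr.
  (* The half with [D] on P_n vanishes: D P_n has degree at most [n], hence is orthogonal to
     P_{n+1}. *)
  rewrite pairing_derivation_opoly_lt// trmx0 mulmx0 addr0.
  have -> : U = v *: opoly n - map_mx c (Aprev Av n)^T *m opoly_prev n.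
    by rewrite Hv addrK.
  rewrite map_mxB map_derivation_mul -mulNmx -map_mxN pairingDl pairing_mull.
  have -> : pairing (map_mx D (opoly_prev n)) (opoly n) = 0.
    case: (n) => [|m]; last exact: pairing_derivation_opoly_lt.
    by rewrite /= raddf0 pairing0l.
  rewrite mulmx0 addr0.
  have -> : map_mx D (v *: opoly n) =
      \sum_(k < n.+1) map_mx c (G n k *m N k.+1) *m monomials k.
    rewrite /opoly scaler_sumr (raddf_sum (map_mx D)); apply: eq_bigr => k _.
    by rewrite map_mxM -mulmxA -DN -map_derivation_mul -scalemxAr.
  (* Each D(v X_k) is again a multiple of X_k, so pairing with P_n keeps only [k = n], where the
     pairing is the inverse of [G n n]. *)
  rewrite pairing_suml big_ord_recr/= big1 ?add0r => [|i _].
    by rewrite pairing_mull pairing_monomials.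
  by rewrite pairing_mull pairing_monomials_lt ?mulmx0.
rewrite -DL.
have -> : map_mx (L \o D) (U *m (opoly n)^T) = pairing
   ((c (4 * a) * v ^+ 3 + c (2 * b) * (v * w ^+ 2) + c (2 * d) * v) *: U)
   (opoly n).
  by apply/matrixP => i j; rewrite !pairingE !mxE big_ord1/= LD !mxE mulrA.
have scaleC p : p *: U = map_mx c (Av n) *m (p *: opoly n.+1).
  by rewrite scalemxAr.
rewrite [v ^+ 3]exprS !scalerDl !pairingDl -!(scalerA (c _)) !pairing_scalar.
rewrite !scaleC !pairing_mull.
rewrite (pairing_quartic n Hv Hv) (pairing_quartic n Hv Hw).
(* The linear term: moving [v] onto P_n leaves only the P_{n+1} component of v P_n, which gives the
   transpose of [Av n]. *)
rewrite pairingZ Hv pairingDr !pairing_mulr pairing_opoly mul1mx.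
have -> : pairing (opoly n.+1) (opoly_prev n) = 0.
  case: (n) => [|m] /=; first by rewrite pairing0r.
  by rewrite pairing_opoly_neq//; lia.
by rewrite mul0mx addr0.
Qed.

End structure_relation.

(** * From pointwise identities to identities of bivariate polynomials *)

Section lifting.
Variable R : realType.
Implicit Types P : {poly {poly R}}.

Lemma poly2_ext P P' : (forall x y, P.[x, y] = P'.[x, y]) -> P = P'.
Proof.
(* A nonzero polynomial over a domain has fewer roots than its size. General [S] allows use over
   [{poly R}] for the outer variable, then over [R] for the inner one, with natural numbers as
   sample points. *)
have poly_ext (S : idomainType) (h : nat -> S) (p p' : {poly S}) :
    injective h -> (forall n, p.[h n] = p'.[h n]) -> p = p'.
  move=> hinj pp'; apply/eqP; rewrite -subr_eq0; apply/eqP.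
  apply: (@roots_geq_poly_eq0 _ _ (map h (iota 0 (size (p - p'))))).
  - by apply/allP => _ /mapP[n _ ->]; rewrite rootE !hornerE pp' subrr.
  - by rewrite map_inj_uniq ?iota_uniq.
  - by rewrite size_map size_iota.
have natr_inj : injective (fun n : nat => n%:R : R).
  by move=> m n /eqP; rewrite eqr_nat => /eqP.
move=> PP'; apply: (poly_ext _ (fun n => n%:R%:P)) => [m n|m].
  by move=> /polyC_inj/natr_inj.
by apply: (poly_ext _ _ _ _ natr_inj) => n; exact: PP'.
Qed.

Definition polyCC : {rmorphism R -> {poly {poly R}}} := polyC \o polyC.

Definition eval2 (z : R * R) : {rmorphism {poly {poly R}} -> R} :=
  horner_eval z.2 \o horner_eval z.1%:P.

Lemma eval2_polyCC z a : eval2 z (polyCC a) = a.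
Proof. by rewrite /= /horner_eval !hornerC. Qed.

Lemma map_eval2_polyCC m n z (A : 'M[R]_(m, n)) :
  map_mx (eval2 z) (map_mx polyCC A) = A.
Proof. by apply/matrixP => i j; rewrite !mxE eval2_polyCC. Qed.

Local Notation monomials := (monomials 'X 'Y).
Local Notation opoly := (opoly polyCC 'X 'Y).

Lemma eval2_monomials k z : map_mx (eval2 z) (monomials k) = Xvec k z.
Proof.
apply/matrixP => i j; rewrite !mxE /= /horner_eval.
by rewrite !(hornerM, horner_exp, hornerX, hornerC).
Qed.

Lemma eval2_opoly G n z : map_mx (eval2 z) (opoly G n) = Pvec G n z.
Proof.
rewrite /opoly /Pvec (raddf_sum (map_mx (eval2 z))); apply: eq_bigr => k _ /=.
by rewrite map_mxM map_eval2_polyCC eval2_monomials.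
Qed.

Lemma three_term_lift (v : {poly {poly R}}) (vz : R * R -> R) G A :
  (forall z, eval2 z v = vz z) ->
  (forall n z, vz z *: Pvec G n z =
     A n *m Pvec G n.+1 z + (Aprev A n)^T *m Pprev G n z) ->
  forall n, v *: opoly G n = map_mx polyCC (A n) *m opoly G n.+1
    + map_mx polyCC (Aprev A n)^T *m opoly_prev polyCC 'X 'Y G n.
Proof.
move=> vE H n; apply/matrixP => i j; apply: poly2_ext => s t.
have prevE z : map_mx (eval2 z) (opoly_prev polyCC 'X 'Y G n) = Pprev G n z.
  by case: (n) => [|m]; [exact: map_mx0 | exact: eval2_opoly].
have : map_mx (eval2 (s, t)) (v *: opoly G n) = map_mx (eval2 (s, t))
    (map_mx polyCC (A n) *m opoly G n.+1
     + map_mx polyCC (Aprev A n)^T *m opoly_prev polyCC 'X 'Y G n).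
  by rewrite map_mxZ map_mxD !map_mxM !map_eval2_polyCC !eval2_opoly prevE vE H.
by move/matrixP/(_ i j); rewrite mxE [RHS]mxE.
Qed.

End lifting.

(** * Integrability of every polynomial against the weight *)

Section weight_integrability.
Variable R : realType.
Implicit Types P : {poly {poly R}}.
Variables (W : R * R -> R) (G : forall n k : nat, 'M[R]_(n.+1, k.+1)).
Hypothesis OG : orthonormal_system W G.
Let wint (f : R * R -> R) :=
  (@leb2 R).-integrable setT (fun z => (f z * W z)%:E).

Lemma weight_integrable0 : wint (fun=> 0).
Proof. by apply: eq_integrable (integrable0 _ _) => // z _; rewrite mul0r. Qed.

Lemma weight_integrableD f g : wint f -> wint g -> wint (fun z => f z + g z).
Proof.
move=> Jf Jg; apply: eq_integrable (integrableD _ Jf Jg) => // z _.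
by rewrite mulrDl EFinD.
Qed.

Lemma weight_integrableZ a f : wint f -> wint (fun z => a * f z).
Proof.
move=> Jf; apply: eq_integrable (integrableZl _ a Jf) => // z _.
by rewrite -mulrA EFinM.
Qed.

Lemma weight_integrable_sum n (f : 'I_n -> R * R -> R) :
  (forall i, wint (f i)) ->
  wint (fun z => \sum_i f i z).
Proof.
move=> Jf; elim: n f Jf => [|n IH] f Jf.
  by under eq_fun do rewrite big_ord0; exact: weight_integrable0.
under eq_fun do rewrite big_ord_recr; apply: weight_integrableD => //.
exact: (IH (fun i => f (widen_ord (leqnSn n) i))).
Qed.

Lemma eq_weight_integrable f g : f =1 g -> wint f -> wint g.
Proof. by move=> /funext ->. Qed.

Lemma weight_integrable_Pvec n i : wint (fun z => Pvec G n z i 0).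
Proof.
have [Gu [+ _]] := OG => /(_ n 0%N i ord0).
move=> /(integrableZl measurableT (G 0%N 0%N 0 0)^-1).
apply: eq_integrable => // z _; rewrite -EFinM; congr (_%:E).
have -> : Pvec G 0 z ord0 0 = G 0%N 0%N 0 0.
  by rewrite /Pvec big_ord1 mxE big_ord1 !mxE !expr0 !mulr1.
rewrite [_ * G _ _ _ _]mulrC -mulrA mulKf//.
by have := Gu 0%N; rewrite unitmxE det_mx11 unitfE.
Qed.

(** Strong induction on the degree, solving the expansion of P_k for its leading term: X_k is the
    inverse of [G k k] applied to P_k minus the lower-degree terms. *)
Lemma weight_integrable_Xvec k i : wint (fun z => Xvec k z i 0).
Proof.
elim/ltn_ind: k i => k IH i; have [Gu _] := OG.
have XE z : Xvec k z i 0 = \sum_l invmx (G k k) i l * (Pvec G k z l 0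
    + -1 * \sum_(j < k) \sum_m G k j l m * Xvec j z m 0).
  have -> : Xvec k z = invmx (G k k) *m
      (Pvec G k z - \sum_(j < k) G k j *m Xvec j z).
    by rewrite /Pvec big_ord_recr /= addrAC subrr add0r mulKmx.
  rewrite mxE; apply: eq_bigr => l _; rewrite mulN1r 2!mxE; congr (_ * (_ - _)).
  by rewrite summxE; apply: eq_bigr => j _; rewrite mxE.
apply: eq_weight_integrable (fsym XE) _.
apply: weight_integrable_sum => l; apply/weight_integrableZ/weight_integrableD.
  exact: weight_integrable_Pvec.
apply/weight_integrableZ/weight_integrable_sum => j.
by apply: weight_integrable_sum => m; apply/weight_integrableZ/IH.
Qed.

Lemma weight_integrable_poly P : wint (fun z => P.[z.1, z.2]).
Proof.
have PE z : P.[z.1, z.2] =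
    (* The monomial x^i y^j is the entry of index [j] in X_{i+j}; [inord] supplies that index. *)
    \sum_(i < size P) \sum_(j < size P`_i) P`_i`_j * Xvec (i + j) z (inord j) 0.
  rewrite [P.[_]]horner_coef horner_sum; apply: eq_bigr => i _.
  rewrite hornerM horner_exp hornerC horner_coef mulr_suml.
  apply: eq_bigr => j _; rewrite mxE inordK ?ltnS ?leq_addl// addnK.
  by rewrite -mulrA [_ ^+ j * _]mulrC.
apply: eq_weight_integrable (fsym PE) _.
apply: weight_integrable_sum => i; apply: weight_integrable_sum => j.
by apply/weight_integrableZ/weight_integrable_Xvec.
Qed.

End weight_integrability.

(** * The two identities for the weight exp(-q) *)

Theorem theorem5p1 (R : realType) (a40 a22 a04 a20 a02 : R)
  (G : forall n k : nat, 'M[R]_(n.+1, k.+1))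
  (A1 A2 : forall n : nat, 'M[R]_(n.+1, n.+2)) :
  0 <= a40 -> 0 <= a22 -> 0 <= a04 ->
  0 < a40 + a22 -> 0 < a22 + a04 ->
  orthonormal_system (weight a40 a22 a04 a20 a02) G ->
  (forall (n : nat) (z : R * R),
      z.1 *: Pvec G n z = A1 n *m Pvec G n.+1 z + (Aprev A1 n)^T *m Pprev G n z) ->
  (forall (n : nat) (z : R * R),
      z.2 *: Pvec G n z = A2 n *m Pvec G n.+1 z + (Aprev A2 n)^T *m Pprev G n z) ->
  forall n : nat,
    (4 * a40) *: (A1 n *m ((A1 n.+1 *m (A1 n.+1)^T) *m (A1 n)^T
        + (A1 n)^T *m (A1 n *m (A1 n)^T + (Aprev A1 n)^T *m Aprev A1 n)))
    + (2 * a22) *: (A1 n *m ((A2 n.+1 *m (A1 n.+1)^T) *m (A2 n)^T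
        + (A2 n)^T *m (A1 n *m (A2 n)^T + (Aprev A1 n)^T *m Aprev A2 n)))
    + (2 * a20) *: (A1 n *m (A1 n)^T)
    = G n n *m N1 R n.+1 *m invmx (G n n)
  /\
    (4 * a04) *: (A2 n *m ((A2 n.+1 *m (A2 n.+1)^T) *m (A2 n)^T
        + (A2 n)^T *m (A2 n *m (A2 n)^T + (Aprev A2 n)^T *m Aprev A2 n)))
    + (2 * a22) *: (A2 n *m ((A1 n.+1 *m (A2 n.+1)^T) *m (A1 n)^T
        + (A1 n)^T *m (A2 n *m (A1 n)^T + (Aprev A2 n)^T *m Aprev A1 n)))
    + (2 * a02) *: (A2 n *m (A2 n)^T)
    = G n n *m N2 R n.+1 *m invmx (G n n).
Proof.
move=> _ _ _ _ _ OG H1 H2 n.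
pose Q : {poly {poly R}} :=
  polyCC R a40 * 'X ^+ 4 + polyCC R a22 * ('X ^+ 2 * 'Y ^+ 2)
  + polyCC R a04 * 'Y ^+ 4 + polyCC R a20 * 'X ^+ 2 + polyCC R a02 * 'Y ^+ 2.
have WE : weight a40 a22 a04 a20 a02 = (fun z => expR (- Q.[z.1, z.2])).
  apply/funext => z; rewrite /weight /Defs.qpoly /Q /=.
  by rewrite !(hornerD, hornerM, horner_exp, hornerX, hornerC) !mulrA.
rewrite WE in OG; have [Gu [_ ortho]] := OG.
have intW P : (@leb2 R).-integrable setT
    (fun z => (P.[z.1, z.2] * expR (- Q.[z.1, z.2]))%:E).
  exact: weight_integrable_poly OG P.
have [L LE] := Rintegral_additive intW.
have LZ a P : L (polyCC R a * P) = a * L P.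
  rewrite !LE -RintegralZl//; last exact: intW.
  by apply: eq_Rintegral => z _; rewrite !(hornerM, hornerC) mulrA.
have Lortho k m i j :
    L (opoly (polyCC R) 'X 'Y G k i 0 * opoly (polyCC R) 'X 'Y G m j 0)
    = ((k == m) && (val i == val j))%:R.
  rewrite -ortho LE /ip; apply: eq_Rintegral => z _; congr (_ * _).
  by rewrite -!eval2_opoly !mxE -rmorphM.
(* Vanishing of the integral of (P_x - Q_x P) exp(-Q), read as a property of [L]; [LY] is its
   analogue in y. *)
have LX P : L (deriv P) = L (deriv Q * P).
  apply/eqP; rewrite -subr_eq0 -raddfB LE; apply/eqP.
  exact: Rintegral_derivX_expR_eq0.
have LY P : L (derivY P) = L (derivY Q * P).
  apply/eqP; rewrite -subr_eq0 -raddfB LE; apply/eqP.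
  exact: Rintegral_derivY_expR_eq0.
have T1 := three_term_lift (v := 'X) (vz := fst) _ H1.
have T2 := three_term_lift (v := 'Y) (vz := snd) _ H2.
have DXc a : deriv (polyCC R a) = 0 by rewrite derivC.
have DYc a : derivY (polyCC R a) = 0 by rewrite derivYC derivC.
have DXx : deriv 'X = polyCC R 1 by rewrite derivX rmorph1.
have DXy : deriv 'Y = polyCC R 0 by rewrite derivC rmorph0.
have DYx : derivY 'X = polyCC R 0 by rewrite derivY_X rmorph0.
have DYy : derivY 'Y = polyCC R 1 by rewrite derivYC derivX rmorph1.
split.
- apply: (structure_relation LZ Gu Lortho (@derivM _) DXc DXx DXy) => //.
  + by apply: T1 => z; rewrite /= /horner_eval hornerX hornerC.
  + by apply: T2 => z; rewrite /= /horner_eval hornerC hornerX.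
  + by move=> k; exact: (derivation_mulX_monomials (@derivM _) DXc DXx DXy).
  + move=> P; rewrite LX (derivation_quartic (@derivM _) DXc DXx DXy).
    by rewrite rmorph1 rmorph0 mulr1 mulr0 addr0.
(* The second identity exchanges the roles of x and y, with [derivY] as derivation and [a04], [a02]
   in place of [a40], [a20]. *)
- apply: (structure_relation LZ Gu Lortho (@derivYM R) DYc DYx DYy) => //.
  + by apply: T2 => z; rewrite /= /horner_eval hornerC hornerX.
  + by apply: T1 => z; rewrite /= /horner_eval hornerX hornerC.
  + by move=> k; exact: (derivation_mulY_monomials (@derivYM R) DYc DYx DYy).
  + move=> P; rewrite LY (derivation_quartic (@derivYM R) DYc DYx DYy).
    by rewrite rmorph1 rmorph0 mulr1 mulr0 add0r.
Qed.
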